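(* Let $n$ be a positive integer. Then the following hold. (a) There exists a basic pair $(\Gamma,G)\in\mathcal{OG}(4)$ with exactly $n$ normal quotients relative to nontrivial intransitive normal subgroups of $G$; these $n$ normal quotients are pairwise non-isomorphic and all of them are $G$-oriented cycles. (b) There exists a basic pair $(\Gamma,G)\in\mathcal{OG}(4)$ with at least $n$ normal quotients which are all $G$-oriented cycles of pairwise coprime lengths. (c) There exists a pair $(\Gamma,G)\in\mathcal{OG}(4)$ with at least $2n$ normal quotients $\Gamma_{N_i}\cong C_{r_i}$ and $\Gamma_{M_i}\cong C_{s_i}$, for $1\leq i\leq n$, such that $\gcd(r_i,r_j)=\gcd(s_i,s_j)=1$ for $i\neq j$, and such that each $\Gamma_{N_i}$ is $G$-oriented while each $\Gamma_{M_i}$ is $G$-unoriented.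
   Context: $\mathcal{OG}(4)$ is the family of all pairs $(\Gamma,G)$ where $\Gamma$ is a finite simple connected undirected graph of valency $4$ and $G\leq\mathrm{Aut}(\Gamma)$ is a vertex-transitive and edge-transitive group of automorphisms with a specified $G$-orbit $\Delta$ on ordered pairs of vertices consisting of exactly one ordered pair $(x,y)$ for each edge $\{x,y\}$. The edge $\{x,y\}$ is oriented from $x$ to $y$ if $(x,y)\in\Delta$. For a normal subgroup $N$ of $G$, the normal quotient $\Gamma_N$ is the graph whose vertices are the $N$-orbits on vertices of $\Gamma$, two distinct $N$-orbits $B,C$ being adjacent if and only if there is at least one edge $\{x,y\}$ of $\Gamma$ with $x\in B$, $y\in C$. It is proper if $N\ne 1$, and it is regarded as one and the same quotient for two normal subgroups having the same vertex-orbits. A pair $(\Gamma,G)\in\mathcal{OG}(4)$ is basic if every proper normal quotient is degenerate, that is, is a single vertex $K_1$, a single edge $K_2$, or a cycle. $C_r$ denotes a cycle of length $r\ge 3$. A normal quotient $\Gamma_N$ that is a cycle is $G$-oriented if it inherits a $G$-invariant edge-orientation from $\Gamma$ (for each pair $B,C$ of adjacent $N$-orbits, all edges of $\Gamma$ between $B$ and $C$ are oriented in the same direction, either all from $B$ to $C$ or all from $C$ to $B$); otherwise it is $G$-unoriented. *)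

(* Defs.v *)
From HB Require Import structures.
From mathcomp Require Import all_boot all_fingroup.
Set Implicit Arguments.
Unset Strict Implicit.
Unset Printing Implicit Defensive.

Import GroupScope.

Record sgraph := SGraph {
  vertex :> finType;
  adj : rel vertex;
  adj_sym : symmetric adj;
  adj_irr : irreflexive adj
}.
Arguments adj {s} _ _.
Arguments SGraph {vertex adj} _ _.

Definition giso (X Y : sgraph) : Prop :=
  exists2 f : X -> Y, bijective f & {mono f : x y / adj x y >-> adj x y}.

Definition complete_rel r : rel 'I_r := fun i j => i != j.

Lemma complete_sym r : symmetric (@complete_rel r).
Proof. by move=> i j; rewrite /complete_rel eq_sym. Qed.

Lemma complete_irr r : irreflexive (@complete_rel r).
Proof. by move=> i; rewrite /complete_rel eqxx. Qed.

Definition complete_graph r : sgraph :=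
  SGraph (@complete_sym r) (@complete_irr r).

Definition cycle_rel r : rel 'I_r :=
  fun i j => (i != j) && ((j == ordS i) || (i == ordS j)).

Lemma cycle_sym r : symmetric (@cycle_rel r).
Proof. by move=> i j; rewrite /cycle_rel eq_sym orbC. Qed.

Lemma cycle_irr r : irreflexive (@cycle_rel r).
Proof. by move=> i; rewrite /cycle_rel eqxx. Qed.

(* This is the cycle C_r only when r >= 3; every use below carries that bound. *)
Definition cycle_graph r : sgraph := SGraph (@cycle_sym r) (@cycle_irr r).

Definition is_Cr (X : sgraph) (r : nat) : Prop :=
  3 <= r /\ giso X (cycle_graph r).

Definition is_cycle (X : sgraph) : Prop := exists r, is_Cr X r.

Definition degenerate (X : sgraph) : Prop :=
  [\/ giso X (complete_graph 1), giso X (complete_graph 2) | is_cycle X].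

Definition gconnected (X : sgraph) : Prop := forall x y : X, connect adj x y.

Definition regular (X : sgraph) (k : nat) : Prop :=
  forall x : X, #|[set y | adj x y]| = k.

Definition edges (X : sgraph) : {set {set X}} :=
  [set [set p.1; p.2] | p : X * X & adj p.1 p.2].

Definition gaut (X : sgraph) : {set {perm X}} :=
  [set g : {perm X} | [forall x, forall y, adj (g x) (g y) == adj x y]].

(* D is the specified orbit of G on ordered pairs of vertices; (x, y) \in D
   means that the edge {x, y} is oriented from x to y. *)
Record OG4 (X : sgraph) (G : {group {perm X}}) (D : {set X * X}) : Prop := {
  OG4_connected : gconnected X;
  OG4_valency : regular X 4;
  OG4_aut : G \subset gaut X;
  OG4_vertex_trans : [transitive G, on [set: X] | 'P];
  OG4_edge_trans : [transitive G, on edges X | 'P^*];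
  OG4_orbit : exists p : X * X, D = [set (g p.1, g p.2) | g : {perm X} in G];
  OG4_arc : forall x y : X, (x, y) \in D -> adj x y;
  OG4_one_arc : forall x y : X,
    adj x y -> ((x, y) \in D) (+) ((y, x) \in D)
}.

Definition vorbits (X : sgraph) (N : {group {perm X}}) : {set {set X}} :=
  [set orbit 'P N x | x : X].

Section Quotient.
Variables (X : sgraph) (P : {set {set X}}).

Definition quot_rel : rel {B : {set X} | B \in P} := fun B C =>
  (B != C) && [exists x in val B, exists y in val C, adj x y].

Lemma quot_sym : symmetric quot_rel.
Proof.
move=> B C; rewrite /quot_rel eq_sym; congr (_ && _).
by apply/exists_inP/exists_inP => -[x xB /exists_inP[y yC xy]];
  exists y => //; apply/exists_inP; exists x => //; rewrite adj_sym.
Qed.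

Lemma quot_irr : irreflexive quot_rel.
Proof. by move=> B; rewrite /quot_rel eqxx. Qed.

Definition quot_graph : sgraph := SGraph quot_sym quot_irr.

(* Meaningful when P is the set of N-orbits of some N <| G. *)
Definition oriented (D : {set X * X}) : Prop :=
  forall B C : quot_graph, adj B C ->
    (forall x y : X, x \in val B -> y \in val C -> adj x y -> (x, y) \in D) \/
    (forall x y : X, x \in val B -> y \in val C -> adj x y -> (y, x) \in D).

End Quotient.

(* A normal quotient is identified with the partition into N-orbits, so that
   normal subgroups with the same vertex-orbits give one and the same quotient. *)
Definition normal_quotient (X : sgraph) (N : {group {perm X}}) : sgraph :=
  quot_graph (vorbits N).

Definition basic (X : sgraph) (G : {group {perm X}}) : Prop :=
  forall N : {group {perm X}}, N <| G -> N :!=: 1 ->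
    degenerate (normal_quotient N).

Definition nontriv_intrans_quotients (X : sgraph) (G : {group {perm X}}) :
    {set {set {set X}}} :=
  [set vorbits N | N : {group {perm X}} &
     [&& N <| G, N :!=: 1 & ~~ [transitive N, on [set: X] | 'P]]].

(* Main.v *)
Require Import Defs.
From HB Require Import structures.
From mathcomp Require Import all_boot all_fingroup.
From mathcomp Require Import all_algebra ring.
Set Implicit Arguments.
Unset Strict Implicit.
Unset Printing Implicit Defensive.

(* All the graphs have vertex set Z_r x B and arcs (i, a) -> (i + 1, b) for
   a ~ b, where ~ is a symmetric relation of valency 2 on B; so all the
   quotients by i mod d, for d dividing r, are oriented cycles.

   For (a) and (b), B has two elements, ~ is total, and G is the wreath product
   of Z_2 by Z_r. A nontrivial normal subgroup N contains elements swapping the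
   two points of a fibre {i} x B, by a commutator argument, so its orbits are
   the classes of i mod d for some d dividing r. Take r = 3^n in (a) and r a
   product of n odd primes in (b).

   For (c), B = Z_r with r a product of n odd primes, a ~ a + 1, and G is the
   direct product of Z_r with the dihedral group of order 2r. Reducing the
   second coordinate modulo the same primes gives unoriented cycles, since both
   (i, a) -> (i + 1, a + 1) and (i, a + 1) -> (i + 1, a) are arcs. *)

Import GroupScope.
Import GRing.Theory.

(** * Partitions of a graph into fibres over a cycle *)

Section Fibres.
Variables (X : sgraph) (e : nat) (f : X -> 'I_e.+1).

Definition fibre i : {set X} := [set x | f x == i].
Definition fibres : {set {set X}} := [set fibre (f x) | x : X].

Lemma fibre_eq x i : x \in fibre i -> fibre i = fibre (f x).
Proof. by rewrite inE => /eqP->. Qed.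

Hypothesis f_adj : forall x y : X, adj x y -> f y = ordS (f x) \/ f x = ordS (f y).
Hypothesis f_onto : forall i, exists x y : X, [/\ f x = i, f y = ordS i & adj x y].

Lemma fibre_in i : fibre i \in fibres.
Proof. by have [x [_ [<- _ _]]] := f_onto i; apply: imset_f. Qed.

(** Edges join only cyclically consecutive fibres by [f_adj], and every consecutive pair is joined
    by [f_onto]. *)
Lemma giso_fibres : giso (quot_graph fibres) (cycle_graph e.+1).
Proof.
(* The default [ord0] is never reached, since members of [fibres] are nonempty. *)
pose g (Q : quot_graph fibres) : cycle_graph e.+1 :=
  if [pick x in val Q] is Some x then f x else ord0.
pose h (i : cycle_graph e.+1) : quot_graph fibres := exist _ (fibre i) (fibre_in i).
have hK : cancel h g.
  move=> i; rewrite /g /h /=; case: pickP => [x|]; first by rewrite inE => /eqP.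
  have [x [_ [fx _ _]]] := f_onto i.
  by move/(_ x); rewrite inE fx eqxx.
have gK : cancel g h.
  move=> Q; apply: val_inj; rewrite /g /=.
  have /imsetP[x _ /= ->] := valP Q; case: pickP => [y /fibre_eq-> //|].
  by move/(_ x); rewrite inE eqxx.
exists g; first by exists h.
move=> P Q; rewrite -{2}(gK P) -{2}(gK Q).
move: (g P) (g Q) => {P Q} i j; apply/idP/idP; rewrite /= /cycle_rel /quot_rel.
  case/andP=> neq_ij ij; apply/andP; split.
    by apply: contra neq_ij => /eqP/(can_inj hK)->.
  case/orP: ij => /eqP->; last rewrite [X in is_true X]/=.
    have [x [y [fx fy xy]]] := f_onto i.
    by apply/exists_inP; exists x; rewrite ?inE ?fx //; apply/exists_inP; exists y; rewrite ?inE ?fy.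
  have [x [y [fx fy xy]]] := f_onto j.
  apply/exists_inP; exists y; rewrite ?inE ?fy //; apply/exists_inP; exists x; rewrite ?inE ?fx //.
  by rewrite adj_sym.
case/andP=> neq_ij /exists_inP[x + /exists_inP[y]]; rewrite !inE => /eqP fy /eqP fx /f_adj.
rewrite fx fy => ij; apply/andP; split; first by apply: contraNneq neq_ij => ->.
by apply/orP; case: ij => ->; [left|right].
Qed.

Lemma is_Cr_fibres : 2 < e.+1 -> is_Cr (quot_graph fibres) e.+1.
Proof. by move=> e_gt; split=> //; apply: giso_fibres. Qed.

Lemma card_fibres : #|quot_graph fibres| = e.+1.
Proof.
by have [g /bij_eq_card-> _] := giso_fibres; rewrite card_ord.
Qed.

(** On 1 or 2 points [cycle_rel] agrees with [complete_rel], which gives K_1 and K_2; all greater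
    lengths give cycles. *)
Lemma degenerate_fibres : degenerate (quot_graph fibres).
Proof.
have [g g_bij g_adj] := giso_fibres.
have eq_giso : cycle_rel (r := e.+1) =2 complete_rel (r := e.+1) ->
    giso (quot_graph fibres) (complete_graph e.+1).
  by move=> E; exists g => // x y; rewrite -g_adj /= E.
case: (leqP 3 e.+1) => [e_gt|]; first by apply: Or33; exists e.+1; apply: is_Cr_fibres.
case: e g g_bij g_adj eq_giso => [|[|//]] _ _ _ E _; [apply: Or31|apply: Or32]; apply: E.
  by move=> i j; rewrite !ord1.
by move=> i j; rewrite /cycle_rel /complete_rel; case: i => [[|[|//]] ?]; case: j => [[|[|//]] ?].
Qed.

Section Kernel.
Variable G : {group {perm X}}.

(** When [G] permutes the fibres, this is the kernel of its action on them. *)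
Definition fibre_ker_set : {set {perm X}} := [set g in G | [forall x, f (g x) == f x]].

Lemma fibre_kerP g :
  reflect (g \in G /\ forall x, f (g x) = f x) (g \in fibre_ker_set).
Proof.
rewrite inE; apply: (iffP andP) => -[gG fg]; split=> //.
  by move=> x; apply/eqP; move/forallP: fg; apply.
by apply/forallP=> x; apply/eqP.
Qed.

Fact fibre_ker_group_set : group_set fibre_ker_set.
Proof.
apply/group_setP; split; first by apply/fibre_kerP; split=> // x; rewrite perm1.
move=> g h /fibre_kerP[gG fg] /fibre_kerP[hG fh]; apply/fibre_kerP; split; first exact: groupM.
by move=> x; rewrite permM fh fg.
Qed.
Definition fibre_ker := Group fibre_ker_group_set.

Lemma fibre_ker_normal :
  (forall g x y, g \in G -> f x = f y -> f (g x) = f (g y)) -> fibre_ker <| G.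
Proof.
move=> fG; apply/andP; split; first by apply/subsetP=> g /fibre_kerP[].
apply/subsetP=> g gG; rewrite inE; apply/subsetP=> _ /imsetP[h /fibre_kerP[hG fh] ->].
apply/fibre_kerP; split; first by rewrite groupJ.
by move=> x; rewrite !permM -{2}(permKV g x); apply: fG.
Qed.

Lemma vorbits_fibre_ker :
    (forall x y, f x = f y -> exists2 g, g \in fibre_ker & g x = y) ->
  vorbits fibre_ker = fibres.
Proof.
move=> tr; apply: eq_imset => x; apply/setP=> y; rewrite inE.
apply/orbitP/eqP => [[g /fibre_kerP[_ fg] <-]|fy]; first exact: fg.
by have [|g gK <-] := tr x y; last exists g.
Qed.
End Kernel.
End Fibres.

(** * Reduction modulo a divisor *)

Definition redn e m (i : 'I_m.+1) : 'I_e.+1 := inZp i.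

Section Reduction.
Variables e m : nat.
Hypothesis dvd_em : e.+1 %| m.+1.
Local Notation red := (@redn e m).

Lemma rednD : {morph red : i j / (i + j)%R}.
Proof. by move=> i j; apply: val_inj; rewrite /= modn_dvdm // modnDm. Qed.

Lemma redn0 : red 0%R = 0%R.
Proof. by apply: val_inj; rewrite /= mod0n. Qed.

Lemma rednN : {morph red : i / (- i)%R}.
Proof. by move=> i; apply/eqP; rewrite -addr_eq0 -rednD addNr redn0. Qed.

Lemma redn_onto i : exists j, red j = i.
Proof.
have ltim : i < m.+1 by apply: leq_trans (dvdn_leq _ dvd_em).
by exists (Ordinal ltim); apply: val_inj; rewrite /= modn_small.
Qed.
End Reduction.

(** In the target [ordS] stands for adding 1, because [e = 0] is allowed there and no ring unit is
    available. *)
Lemma redn1 e m (i : 'I_m.+3) : e.+1 %| m.+3 -> redn e (i + 1)%R = ordS (redn e i).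
Proof.
move=> dvd_em; rewrite rednD //; apply: val_inj => /=.
by rewrite [1 %% m.+3]modn_small // modnDm -[in RHS]addn1 modnDml.
Qed.

(** A modulus greater than 2 does not divide 2. Hence a step forward on the cycle is never a step
    backward, which fixes directions in the quotients. *)
Lemma ordS2_neq d (a : 'I_d.+1) : 2 < d.+1 -> ordS (ordS a) != a.
Proof.
move=> d_gt2; rewrite -val_eqE /= -[X in _ != X](modn_small (ltn_ord a)).
rewrite -addn1 modnDml addn1 -addn2 -[X in _ != X %[mod _]]addn0 eqn_modDl.
by rewrite !modn_small.
Qed.

(** * Graphs on Z_r x B and groups transitive on their arcs *)

Section CycleProduct.
Variables (m : nat) (B : finType) (e : rel B).

(** The length r is written [m.+3]: the type itself ensures that r is at least 3, so that no arc is
    the reverse of another. *)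
Definition parc : rel ('I_m.+3 * B) := fun x y => (y.1 == x.1 + 1)%R && e x.2 y.2.
Definition padj : rel ('I_m.+3 * B) := fun x y => parc x y || parc y x.

Lemma padj_sym : symmetric padj.
Proof. by move=> x y; rewrite /padj orbC. Qed.

Lemma padj_irr : irreflexive padj.
Proof. by move=> x; rewrite /padj orbb /parc -subr_eq0 opprD addNKr oppr_eq0 oner_eq0. Qed.

Definition pgraph : sgraph := SGraph padj_sym padj_irr.

Lemma addr1_1_neq (i : 'I_m.+3) : (i + 1 + 1 != i)%R.
Proof. by rewrite -addrA -subr_eq0 (addrC i) addrK. Qed.

Lemma parc_asym x y : parc x y -> ~~ parc y x.
Proof.
case/andP=> /eqP y1 _; apply/negP; case/andP=> /eqP; rewrite y1 => /esym/eqP.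
by rewrite (negPf (addr1_1_neq _)).
Qed.

Definition parcs : {set pgraph * pgraph} := [set p | parc p.1 p.2].


Section Transitive.
Hypotheses (e_sym : symmetric e) (e_2 : forall a, #|[set b | e a b]| = 2).
Variable G : {group {perm pgraph}}.
Hypothesis G_parc : forall g x y, g \in G -> parc x y -> parc (g x) (g y).
Hypothesis G_arc_trans : forall x y x' y', parc x y -> parc x' y' ->
  exists2 g : {perm pgraph}, g \in G & g x = x' /\ g y = y'.

Lemma parc_next x : exists b, parc x (x.1 + 1, b)%R.
Proof.
have /card_gt0P[b xb] : 0 < #|[set b | e x.2 b]| by rewrite e_2.
by rewrite inE in xb; exists b; rewrite /parc eqxx.
Qed.

Lemma pgraph_trans (x y : pgraph) : exists2 g : {perm pgraph}, g \in G & g x = y.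
Proof.
have [[b xb] [c yc]] := (parc_next x, parc_next y).
by have [g gG [gx _]] := G_arc_trans xb yc; exists g.
Qed.

Lemma parc_mono g x y : g \in G -> parc (g x) (g y) = parc x y.
Proof.
move=> gG; apply/idP/idP; last exact: G_parc.
by rewrite -groupV in gG; move/(G_parc gG); rewrite !permK.
Qed.

(** As [e] is symmetric, the neighbours of [x] form the product of the two first coordinates next to
    [x.1] and the two elements related to [x.2]. *)
Lemma pgraph_valency : regular pgraph 4.
Proof.
move=> x; pose S := [set (x.1 + 1)%R; (x.1 - 1)%R].
have <- : #|setX S [set b | e x.2 b]| = 4.
  rewrite cardsX e_2 cards2; case: eqP => // /eqP; rewrite eq_sym subr_eq eq_sym.
  by rewrite (negPf (addr1_1_neq _)).
apply: eq_card => y; rewrite !inE /= /padj /parc (e_sym y.2).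
by rewrite -andb_orl [in RHS]eq_sym [(y.1 == x.1 - 1)%R]eq_sym subr_eq (eq_sym y.1).
Qed.

(** The arcs form a single [G]-orbit. Every vertex starts an arc, which gives vertex-transitivity;
    every edge is an arc in exactly one direction, which gives edge-transitivity. *)
Lemma OG4_pgraph : pgraph -> gconnected pgraph -> OG4 G parcs.
Proof.
move=> x0 conn; have [b x0b] := parc_next x0; set y0 := (_, b) in x0b.
split=> //.
- exact: pgraph_valency.
- apply/subsetP=> g gG; rewrite inE; apply/forallP=> x; apply/forallP=> y.
  by rewrite /= /padj !parc_mono.
- apply/imsetP; exists x0 => //; apply/setP=> x; rewrite inE; apply/esym/orbitP.
  by have [g gG gx] := pgraph_trans x0 x; exists g.
- have arc_edge x y : parc x y -> [set x; y] \in orbit 'P^* G [set x0; y0].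
    move=> xy; have [g gG [<- <-]] := G_arc_trans x0b xy.
    by apply/orbitP; exists g => //; rewrite /= /setact imsetU1 imset_set1.
  apply/imsetP; exists [set x0; y0].
    by apply/imsetP; exists (x0, y0) => //; rewrite inE /= /padj x0b.
  apply/setP=> E; apply/imsetP/idP => [[[x y] + ->]|/orbitP[g gG <-]].
    by rewrite inE => /orP[] /arc_edge //; rewrite setUC.
  exists (g x0, g y0); first by rewrite inE /= /padj parc_mono ?x0b.
  by rewrite /= /setact imsetU1 imset_set1.
- exists (x0, y0); apply/setP=> -[x y]; rewrite inE /=; apply/idP/imsetP => [xy|[g gG [-> ->]]].
    by have [g gG [gx gy]] := G_arc_trans x0b xy; exists g; rewrite //= gx gy.
  by rewrite parc_mono.
- by move=> x y; rewrite inE /= /padj => ->.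
move=> x y; rewrite !inE /= => /orP[] xy; rewrite xy (negPf (parc_asym xy)) //.
Qed.

Section FstQuotient.
Variable d : nat.
Hypothesis dvd_d : d.+1 %| m.+3.

Definition fst_mod (x : pgraph) : 'I_d.+1 := redn d x.1.

Lemma fst_mod_adj (x y : pgraph) :
  adj x y -> fst_mod y = ordS (fst_mod x) \/ fst_mod x = ordS (fst_mod y).
Proof.
by rewrite /fst_mod => /orP[] /andP[/eqP-> _]; rewrite redn1 //; [left|right].
Qed.

Lemma fst_mod_onto : pgraph -> forall i, exists x y : pgraph,
  [/\ fst_mod x = i, fst_mod y = ordS i & adj x y].
Proof.
move=> x0 i; have [j ji] := redn_onto dvd_d i; have [b jb] := parc_next (j, x0.2).
exists (j, x0.2), ((j, x0.2).1 + 1, b)%R; rewrite /fst_mod redn1 //= ji; split=> //.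
by rewrite /padj jb.
Qed.

(** If the arc went from [y] to [x], two forward steps would return to the same residue, against
    [ordS2_neq]. *)
Lemma parc_fst_mod (x y : pgraph) :
  2 < d.+1 -> fst_mod y = ordS (fst_mod x) -> adj x y -> parc x y.
Proof.
move=> d_gt2 xy /orP[//|/andP[/eqP x1 _]]; move: xy; rewrite /fst_mod x1 redn1 //.
by move/esym/eqP; rewrite (negPf (ordS2_neq _ d_gt2)).
Qed.

(** A single edge between two classes decides which class follows the other, and [parc_fst_mod] then
    directs all edges between them the same way. *)
Lemma fst_mod_oriented : 2 < d.+1 -> oriented (fibres fst_mod) parcs.
Proof.
move=> d_gt2 P Q; have [/imsetP[x0 _ Px0] /imsetP[y0 _ Qy0]] := (valP P, valP Q).
case/andP=> _ /exists_inP[x + /exists_inP[y + xy]]; rewrite /= in Px0 Qy0 *.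
rewrite Px0 Qy0 !inE => /eqP x_x0 /eqP y_y0.
case: (fst_mod_adj xy) => /eqP; rewrite x_x0 y_y0 => /eqP E; [left|right].
  move=> z t; rewrite !inE => /eqP z_x0 /eqP t_y0 /=.
  by apply: parc_fst_mod => //; rewrite z_x0 t_y0.
move=> z t; rewrite !inE => /eqP z_x0 /eqP t_y0 /=; rewrite padj_sym.
by apply: parc_fst_mod => //; rewrite z_x0 t_y0.
Qed.

Hypothesis G_shift : forall g, g \in G -> exists c, forall x, ((g x).1 = x.1 + c)%R.

Lemma fst_mod_ker_normal : fibre_ker fst_mod G <| G.
Proof.
apply: fibre_ker_normal => g x y /G_shift[c gc] xy.
by rewrite /fst_mod !gc !rednD // [redn d x.1]xy.
Qed.

(** An element carrying [x] to [y] in the same class shifts by some [c] that vanishes modulo [d.+1],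
    so it preserves every class. *)
Lemma fst_mod_vorbits : vorbits (fibre_ker fst_mod G) = fibres fst_mod.
Proof.
apply: vorbits_fibre_ker => x y xy; have [g gG gx] := pgraph_trans x y.
exists g => //; apply/fibre_kerP; split=> // z.
have [c gc] := G_shift gG; rewrite /fst_mod gc rednD //.
suff ->: redn d c = 0%R by rewrite addr0.
by apply: (addrI (redn d x.1)); rewrite -rednD // -gc gx addr0.
Qed.
End FstQuotient.
End Transitive.
End CycleProduct.

(** * The graph with two-point fibres and its wreath product *)

Definition full_rel : rel bool := fun _ _ => true.

Lemma card_full_rel a : #|[set b | full_rel a b]| = 2.
Proof. by rewrite cardsT card_bool. Qed.

Section Wreath.
Variable m : nat.
Let X := pgraph m full_rel.

(** A permutation shifting the first coordinate by a constant maps each two-point fibre onto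
    another, in one of two ways chosen independently for each fibre. These permutations form the
    wreath product of Z_2 by Z_r. *)
Definition wreath_set : {set {perm X}} :=
  [set g : {perm X} | [exists c, [forall x, (g x).1 == x.1 + c]]]%R.

Lemma wreathP (g : {perm X}) :
  reflect (exists c, forall x, (g x).1 = x.1 + c)%R (g \in wreath_set).
Proof.
rewrite inE; apply: (iffP existsP) => -[c gc]; exists c.
  by move=> x; apply/eqP; move/forallP: gc; apply.
by apply/forallP=> x; apply/eqP.
Qed.

Fact wreath_group_set : group_set wreath_set.
Proof.
apply/group_setP; split; first by apply/wreathP; exists 0%R => x; rewrite perm1 addr0.
move=> g h /wreathP[c gc] /wreathP[d hd]; apply/wreathP; exists (c + d)%R => x.
by rewrite permM hd gc addrA.
Qed.
Definition wreath := Group wreath_group_set.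

Definition twist c (s : 'I_m.+3 -> bool) (x : X) : X := (x.1 + c, s x.1 (+) x.2)%R.

Lemma twist_inj c s : injective (twist c s).
Proof.
by move=> [i a] [j b] /eqP; rewrite xpair_eqE /= => /andP[/eqP/addIr-> /eqP/addbI->].
Qed.

Lemma twist_wreath c s : perm (@twist_inj c s) \in wreath.
Proof. by apply/wreathP; exists c => x; rewrite permE. Qed.

Lemma wreath_parc (g : {perm X}) x y : g \in wreath -> 
  parc full_rel x y -> parc full_rel (g x) (g y).
Proof.
by case/wreathP=> c gc; rewrite /parc !gc !andbT => /eqP->; rewrite addrAC.
Qed.

Lemma wreath_arc_trans x y x' y' :
    parc full_rel x y -> parc full_rel x' y' ->
  exists2 g : {perm X}, g \in wreath & g x = x' /\ g y = y'.
Proof.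
case: x y x' y' => [i a] [j b] [i' a'] [j' b'].
rewrite /parc /= !andbT => /eqP-> /eqP->.
(* The fibres over [i] and [i + 1] differ, so the second coordinates of the two ends can be
   corrected independently. *)
pose s k := if k == i then a (+) a' else b (+) b'.
exists (perm (@twist_inj (i' - i)%R s)); first exact: twist_wreath.
rewrite !permE /twist /s /= eqxx addrC subrK; split; first by rewrite addbAC addbb.
have /negPf->: (i + 1 != i)%R by rewrite -subr_eq0 addrC addKr oner_eq0.
by rewrite addrAC [(i + _)%R]addrC subrK addbAC addbb.
Qed.

Lemma wreath_connected : gconnected X.
Proof.
have step x b : connect (@adj X) x (x.1 + 1, b)%R.
  by apply: connect1; rewrite /= /padj /parc eqxx.
have walk x n b : connect (@adj X) x (x.1 + n.+1%:R, b)%R.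
  elim: n b => [|n IHn] b; first exact: step.
  by apply: connect_trans (IHn b) _; rewrite (mulrSr _ n.+1) addrA; apply: (step (_, b)).
(* A full extra turn of [m.+3] steps is added, so that there is at least one step and the last one
   can choose the second coordinate. *)
move=> x y; have := walk x (m.+2 + (y.1 - x.1)%R)%N y.2.
suff ->: ((m.+2 + (y.1 - x.1)%R)%N.+1%:R = y.1 - x.1 :> 'I_m.+3)%R.
  by rewrite addrC subrK; case: (y).
by rewrite Zp_nat -addSn; apply: val_inj; rewrite /= modnDl modn_mod.
Qed.

Lemma OG4_wreath : OG4 wreath (parcs m full_rel).
Proof.
apply: OG4_pgraph => //; first exact: card_full_rel.
- exact: wreath_parc.
- exact: wreath_arc_trans.
- exact: (ord0, true).
exact: wreath_connected.
Qed.

Definition flip (x : X) : X := (x.1, ~~ x.2).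

(** A group element maps two-point fibres to two-point fibres, so it sends the other point of a
    fibre to the other point of its image. *)
Lemma flip_wreath (g : {perm X}) x : g \in wreath -> g (flip x) = flip (g x).
Proof.
case: x => i a /wreathP[c gc]; rewrite /flip /=.
have: g (i, ~~ a) != g (i, a) by rewrite (inj_eq perm_inj); case: (a); rewrite xpair_eqE andbF.
case E1: (g (i, ~~ a)) (gc (i, ~~ a)) => [i1 a1] /= ->.
case E2: (g (i, a)) (gc (i, a)) => [i2 a2] /= ->.
by rewrite xpair_eqE eqxx /=; case: (a1); case: (a2).
Qed.

(** * Orbits of the nontrivial normal subgroups *)

Section Normal.
Variable N : {group {perm X}}.
Hypotheses (nNG : N <| wreath) (ntN : N :!=: 1).

(** Consequently an orbit of [N] is a union of whole two-point fibres and is determined by its first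
    coordinates. *)
Lemma flip_orbit x : flip x \in orbit 'P N x.
Proof.
have sNG := normal_sub nNG.
(* One such vertex is enough: conjugating [k] by an element that carries [y] to [x] stays in [N],
   and group elements commute with [flip]. *)
suff [y [k kN ky]] : exists y, exists2 k : {perm X}, k \in N & k y = flip y.
  have [g gG gy] := pgraph_trans card_full_rel wreath_arc_trans y x.
  apply/orbitP; exists (k ^ g); first by rewrite memJ_norm // (subsetP (normal_norm nNG)).
  by rewrite /= apermE conjgE !permM -gy permK ky flip_wreath.
have /trivgPn[h hN h_neq1] := ntN.
have [y hy] : exists y, h y != y.
  apply/existsP; apply: contraR h_neq1 => /existsPn fix_h.
  by apply/eqP/permP=> y; rewrite perm1; apply/eqP; rewrite -[_ == _]negbK.
exists y; have hG := subsetP sNG _ hN; have [hy1|hy1] := eqVneq (h y).1 y.1.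
  exists h => //; move: hy hy1; rewrite /flip; case: y => j b; case: (h _) => i a /= + ij; rewrite {}ij.
  by rewrite xpair_eqE eqxx; case: a; case: b.
(* The commutator of h with the flip of the single fibre through y moves y
   within that fibre. *)
pose v := perm (@twist_inj 0%R (fun i => i == y.1)).
have vG : v \in wreath by apply: twist_wreath.
exists (h ^ v * h^-1); first by rewrite groupMr ?groupV // memJ_norm // (subsetP (normal_norm nNG)).
have vflip z : z.1 = y.1 -> v z = flip z.
  by case: z => i a /= ->; rewrite permE /twist /= eqxx addr0.
have vfix z : z.1 != y.1 -> v z = z.
  by case: z => i a /= /negPf i_y; rewrite permE /twist /= i_y addr0.
have flipK z : flip (flip z) = z by case: z => i a; rewrite /flip /= negbK.
have vVy : v^-1 y = flip y.
  by apply: (canLR (permK v)); rewrite vflip ?flipK.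
rewrite conjgE !permM vVy flip_wreath // vfix //.
by rewrite -flip_wreath // permK.
Qed.
(** Shifts are indexed by natural numbers rather than residues, so that a least positive one exists
    and can be subtracted from the others. *)
Definition shift_in k := [exists h in N, [forall x, (h x).1 == x.1 + k%:R]]%R.

Lemma shift_inP k :
  reflect (exists2 h, h \in N & forall x, ((h x).1 = x.1 + k%:R)%R) (shift_in k).
Proof.
apply: (iffP exists_inP) => -[h hN hk]; exists h => //.
  by move=> x; apply/eqP; move/forallP: hk; apply.
by apply/forallP=> x; apply/eqP.
Qed.

Lemma shift_inD k l : shift_in k -> shift_in l -> shift_in (k + l).
Proof.
case/shift_inP=> g gN gk /shift_inP[h hN hl]; apply/shift_inP; exists (g * h); first exact: groupM.
by move=> x; rewrite permM hl gk natrD addrA.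
Qed.

Lemma shift_inB k l : l <= k -> shift_in k -> shift_in l -> shift_in (k - l).
Proof.
move=> le_lk /shift_inP[g gN gk] /shift_inP[h hN hl]; apply/shift_inP.
exists (h^-1 * g) => [|x]; first by rewrite groupM ?groupV.
by rewrite permM gk natrB // -{2}(permKV h x) hl -addrA [(l%:R + _)%R]addrC subrK.
Qed.

(** The shifts realised by [N] are the multiples of the least positive one, [d.+1]. This settles the
    first coordinates of an orbit, and [flip_orbit] the second ones. *)
Lemma vorbits_normal_wreath : exists2 d, d.+1 %| m.+3 &
  vorbits N = fibres (@fst_mod m _ full_rel d).
Proof.
(* The identity shifts by r, which is zero in Z_r; this gives both a positive shift and, later, the
   divisibility of r. *)
have sub_r : shift_in m.+3.
  by apply/shift_inP; exists 1 => // x; rewrite perm1 (pchar_Zp _ : m.+3%:R = 0)%R ?addr0.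
have ex_shift : exists k, (0 < k) && shift_in k by exists m.+3.
case: (ex_minnP ex_shift) => -[|d] //= shift_d min_d.
(* Division by repeated subtraction: a shift below [d.+1] must be 0 by minimality. *)
have dvd_shift k : shift_in k -> d.+1 %| k.
  elim/ltn_ind: k => k IHk shift_k; case: (ltnP k d.+1) => [|le_dk].
    by case: k shift_k {IHk} => // k shift_k; rewrite ltnNge min_d.
  rewrite -(subnK le_dk) dvdn_addl //; apply: IHk; last exact: shift_inB.
  by rewrite -subn_gt0 subKn.
have shift_mul k : shift_in (k * d.+1).
  elim: k => [|k IHk]; last by rewrite mulSn shift_inD.
  by apply/shift_inP; exists 1 => // x; rewrite perm1 addr0.
have dvd_d := dvd_shift _ sub_r; exists d => //.
apply: eq_imset => x; apply/setP=> y; rewrite inE; apply/orbitP/eqP => [[h hN <-]|xy].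
  have /wreathP[c hc] := subsetP (normal_sub nNG) _ hN.
  have /dvd_shift : shift_in c by apply/shift_inP; exists h => // z; rewrite hc natr_Zp.
  move=> /eqP c_d; have c0 : redn d c = 0%R by apply: val_inj.
  by rewrite /fst_mod /= apermE hc rednD // c0 addr0.
have {}xy : redn d y.1 = redn d x.1 by [].
have /dvdnP[k Ek] : d.+1 %| (y.1 - x.1)%R.
  have : redn d (y.1 - x.1)%R = 0%R.
    by rewrite rednD // rednN // xy subrr.
  by move/(congr1 val) => /= /eqP.
have /shift_inP[h hN hk] := shift_mul k.
have hx : (h x).1 = y.1 by rewrite hk -Ek natr_Zp addrC subrK.
have /orbitP[g gN gx] := flip_orbit (h x).
(* Now [h x] lies in the two-point fibre of [y], so it is either [y] or [flip y]; in the second case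
   [g] corrects it. *)
have [hxy|hxy] := eqVneq (h x) y; first by exists h.
exists (h * g); first exact: groupM.
rewrite /= apermE permM -[g _]/(aperm _ g) [aperm _ g]gx.
move: hx hxy; rewrite /flip; case: (y) => j b; case: (h x) => i a /= ->.
by rewrite xpair_eqE eqxx; case: (a); case: (b).
Qed.
End Normal.
End Wreath.

(** * The normal quotients of the wreath product pair *)

Section WreathQuotients.
Variable m : nat.
Local Notation q d := (fibres (@fst_mod m _ full_rel d)).
Let x0 : pgraph m full_rel := (ord0, true).

Lemma wreath_shift (g : {perm pgraph m full_rel}) :
  g \in wreath m -> exists c, forall x, ((g x).1 = x.1 + c)%R.
Proof. by move/wreathP. Qed.

Lemma wreath_basic : basic (wreath m).
Proof.
move=> N nNG ntN; rewrite /normal_quotient; have [d dvd_d ->] := vorbits_normal_wreath nNG ntN.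
apply: degenerate_fibres; first exact: fst_mod_adj.
exact: @fst_mod_onto m _ full_rel (@card_full_rel) d dvd_d x0.
Qed.

Lemma wreath_is_Cr d : d.+1 %| m.+3 -> 2 < d.+1 -> is_Cr (quot_graph (q d)) d.+1.
Proof.
move=> dvd_d d_gt2; apply: is_Cr_fibres => //; first exact: fst_mod_adj.
exact: @fst_mod_onto m _ full_rel (@card_full_rel) d dvd_d x0.
Qed.

Lemma card_wreath_quotient d : d.+1 %| m.+3 -> #|quot_graph (q d)| = d.+1.
Proof.
move=> dvd_d; apply: card_fibres; first exact: fst_mod_adj.
exact: @fst_mod_onto m _ full_rel (@card_full_rel) d dvd_d x0.
Qed.

Lemma wreath_quotient_inj d d' : d.+1 %| m.+3 -> d'.+1 %| m.+3 -> q d = q d' -> d = d'.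
Proof.
move=> dvd_d dvd_d' /(congr1 (fun P => #|quot_graph P|)).
by rewrite !card_wreath_quotient // => -[].
Qed.

Lemma wreath_ker_normal d : d.+1 %| m.+3 -> fibre_ker (@fst_mod m _ full_rel d) (wreath m) <| wreath m.
Proof. by move=> dvd_d; apply: fst_mod_ker_normal => // g /wreath_shift. Qed.

Lemma wreath_ker_vorbits d :
  d.+1 %| m.+3 -> vorbits (fibre_ker (@fst_mod m _ full_rel d) (wreath m)) = q d.
Proof.
move=> dvd_d; apply: fst_mod_vorbits => //.
- exact: card_full_rel.
- exact: wreath_arc_trans.
by move=> g /wreath_shift.
Qed.

Lemma transitive_fst_mod (N : {group {perm pgraph m full_rel}}) d :
  d.+1 %| m.+3 -> vorbits N = q d -> [transitive N, on [set: pgraph m full_rel] | 'P] = (d == 0).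
Proof.
move=> dvd_d Nq; have trN x : orbit 'P N x = fibre (fst_mod d) (fst_mod d x).
  have : orbit 'P N x \in q d by rewrite -Nq imset_f.
  by case/imsetP=> y _ E; rewrite E; apply: fibre_eq; rewrite -E orbit_refl.
apply/idP/eqP => [tr|d0].
  (* For positive [d] a vertex of residue 1 is outside the class of [x0], which has residue 0, so
     one orbit cannot cover all vertices. *)
  have [y [_ [y1 _ _]]] := @fst_mod_onto m _ full_rel (@card_full_rel) d dvd_d x0 (inord 1).
  have : y \in orbit 'P N x0 by rewrite (atransP tr) ?inE.
  rewrite trN inE y1; case: (d) => // d' /eqP/(congr1 val).
  by rewrite /= inordK // mod0n.
apply/imsetP; exists x0 => //; apply/esym/setP=> x; rewrite trN !inE.
by move: (fst_mod d x) (fst_mod d x0); rewrite d0 => i j; rewrite !ord1.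
Qed.

Lemma mem_wreath_quotients P :
  reflect (exists d, [/\ d.+1 %| m.+3, 0 < d & P = q d])
          (P \in nontriv_intrans_quotients (wreath m)).
Proof.
apply: (iffP imsetP) => [[N] | [d [dvd_d d_gt0 ->]]].
  rewrite inE => /and3P[nNG ntN ntr] ->.
  have [d dvd_d Nd] := vorbits_normal_wreath nNG ntN; exists d; split=> //.
  by rewrite lt0n -(transitive_fst_mod dvd_d Nd).
exists (fibre_ker (@fst_mod m _ full_rel d) (wreath m)); last by rewrite wreath_ker_vorbits.
rewrite inE wreath_ker_normal // (transitive_fst_mod dvd_d) ?wreath_ker_vorbits //.
rewrite -lt0n d_gt0 andbT; apply/trivgPn.
(* Swapping the points of every fibre is a nontrivial element of the kernel for each [d], even when
   [d.+1] is the whole length r. *)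
exists (perm (@twist_inj m 0%R (fun=> true))).
  apply/fibre_kerP; split=> [|x]; first exact: twist_wreath.
  by rewrite permE /fst_mod /= addr0.
by apply/eqP=> /permP/(_ x0); rewrite permE perm1.
Qed.
End WreathQuotients.

(** * The case r = 3^n: a chain of exactly n quotients *)

Lemma nontriv_intrans_quotients_wreath3 n m : (3 ^ n)%N = m.+3 ->
  nontriv_intrans_quotients (wreath m) =
    [set fibres (@fst_mod m _ full_rel (3 ^ i.+1)%N.-1) | i : 'I_n].
Proof.
move=> Em; apply/setP=> P; apply/mem_wreath_quotients/imsetP => [[d [dvd_d d_gt0 ->]]|[i _ ->]].
  (* A divisor of 3^n is a power of 3; the exponent 0 is the transitive case, excluded by
     [d_gt0]. *)
  move: dvd_d; rewrite -Em => /dvdn_pfactor[] // -[|k] le_kn Ed.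
    by case: Ed d_gt0 => ->.
  by exists (Ordinal le_kn); rewrite //= -Ed.
exists (3 ^ i.+1)%N.-1; rewrite prednK ?expn_gt0 // -Em dvdn_exp2l //; split=> //.
by rewrite -ltnS prednK ?expn_gt0 // (ltn_exp2l 0).
Qed.

(** The quotients are cycles of lengths 3, 9, ..., 3^n, told apart by their numbers of vertices. *)
Lemma exists_basic_n_oriented n : 0 < n ->
  exists (X : sgraph) (G : {group {perm X}}) (D : {set X * X}),
    [/\ OG4 G D, basic G,
        #|nontriv_intrans_quotients G| = n,
        (forall P Q, P \in nontriv_intrans_quotients G ->
           Q \in nontriv_intrans_quotients G -> P <> Q ->
           ~ giso (quot_graph P) (quot_graph Q))
      & forall P, P \in nontriv_intrans_quotients G ->
           is_cycle (quot_graph P) /\ oriented P D].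
Proof.
move=> n_gt0; have [m Em] : exists m, (3 ^ n)%N = m.+3.
  by exists (3 ^ n - 3)%N; rewrite -[RHS]addn3 subnK // -[X in X <= _](expn1 3) leq_exp2l.
exists (pgraph m full_rel), (wreath m), (parcs _ _).
have dvd_i (i : 'I_n) : (3 ^ i.+1)%N.-1.+1 %| m.+3.
  by rewrite prednK ?expn_gt0 // -Em dvdn_exp2l.
have q_inj : injective (fun i : 'I_n => fibres (@fst_mod m _ full_rel (3 ^ i.+1)%N.-1)).
  move=> i j /wreath_quotient_inj-/(_ (dvd_i i) (dvd_i j)) E.
  apply/val_inj; have : (3 ^ i.+1 = 3 ^ j.+1)%N by rewrite -[LHS]prednK ?E ?prednK ?expn_gt0.
  by move/eqP; rewrite eqn_exp2l // => /eqP[].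
rewrite (nontriv_intrans_quotients_wreath3 Em); split.
- exact: OG4_wreath.
- exact: wreath_basic.
- by rewrite card_imset // card_ord.
- move=> _ _ /imsetP[i _ ->] /imsetP[j _ ->] neq_ij [h /bij_eq_card].
  rewrite !card_wreath_quotient // => -[E] _; apply: neq_ij.
  by rewrite E.
move=> _ /imsetP[i _ ->].
have i_gt : 2 < (3 ^ i.+1)%N.-1.+1.
  by rewrite prednK ?expn_gt0 // -[X in X <= _](expn1 3) leq_exp2l.
split; last exact: fst_mod_oriented.
by exists (3 ^ i.+1)%N.-1.+1; apply: wreath_is_Cr.
Qed.

(** * Products of distinct odd primes and pairwise coprime lengths *)

Lemma odd_primes n : exists p : 'I_n -> nat,
  injective p /\ forall i, prime (p i) && (2 < p i).
Proof.
(* Starting from 3 and passing each time to a larger prime avoids 2 and never repeats a value. *)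
pose p k := iter k (fun l => s2val (prime_above l)) 3.
have p_incr k : p k < p k.+1 by rewrite /=; case: (prime_above _).
have p_mono : {homo p : i j / i < j} by apply: homo_ltn => //; apply: ltn_trans.
exists (p \o val); split=> [i j /= E|i /=]; last first.
  elim: {i}(val i) => // k /andP[_ k_gt]; rewrite (ltn_trans k_gt) // andbT.
  by rewrite /=; case: (prime_above _).
by apply: val_inj; case: (ltngtP i j) => // /p_mono; rewrite E ltnn.
Qed.

(** The length [m.+3] is a product of [n] distinct odd primes and each [(d i).+1] is one of them.
    That the product is odd serves later to invert 2. *)
Lemma coprime_moduli n : 0 < n -> exists m (d : 'I_n -> nat),
  [/\ odd m.+3, injective d, forall i, (d i).+1 %| m.+3 /\ 2 < (d i).+1
    & forall i j, i != j -> coprime (d i).+1 (d j).+1].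
Proof.
move=> n_gt0; have [p [p_inj p_prime]] := odd_primes n.
pose r := (\prod_(i < n) p i)%N.
have dvd_r i : p i %| r by rewrite /r (bigD1 i) //= dvdn_mulr.
have r_gt0 : 0 < r.
  by apply: prodn_gt0 => i; have /andP[_ /ltnW/ltnW] := p_prime i.
have r_gt2 : 2 < r.
  have /andP[_ p_gt2] := p_prime (Ordinal n_gt0).
  by apply: leq_trans p_gt2 (dvdn_leq r_gt0 (dvd_r _)).
have r_odd : odd r.
  apply: (big_ind odd) => // [k l|i _]; first by rewrite oddM => -> ->.
  by have /andP[/even_prime[->|]] := p_prime i.
exists (r - 3)%N, (fun i => (p i).-1); have -> : (r - 3)%N.+3 = r by rewrite -[LHS]addn3 subnK.
have pK i : (p i).-1.+1 = p i by rewrite prednK //; have /andP[/prime_gt0] := p_prime i.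
split=> // [i j /(congr1 S)|i|i j neq_ij]; rewrite !pK; first exact: p_inj.
  by have /andP[] := p_prime i.
have [/andP[pi _] /andP[pj _]] := (p_prime i, p_prime j).
by rewrite prime_coprime // dvdn_prime2 // (inj_eq p_inj).
Qed.

Lemma exists_basic_coprime_oriented n : 0 < n ->
  exists (X : sgraph) (G : {group {perm X}}) (D : {set X * X}),
    [/\ OG4 G D, basic G
      & exists (N : 'I_n -> {group {perm X}}) (r : 'I_n -> nat),
        [/\ injective (fun i => vorbits (N i)),
            (forall i, [/\ N i <| G, is_Cr (normal_quotient (N i)) (r i)
                         & oriented (vorbits (N i)) D])
          & forall i j, i != j -> coprime (r i) (r j)]].
Proof.
case/coprime_moduli=> m [d [_ d_inj dvd_d d_coprime]].
exists (pgraph m full_rel), (wreath m), (parcs _ _).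
split; [exact: OG4_wreath | exact: wreath_basic |].
exists (fun i => fibre_ker (@fst_mod m _ full_rel (d i)) (wreath m)), (fun i => (d i).+1).
split=> // [i j|i]; have [dvd_di di_gt2] := dvd_d i.
  have [dvd_dj _] := dvd_d j; rewrite !wreath_ker_vorbits //.
  by move/wreath_quotient_inj=> /(_ dvd_di dvd_dj)/d_inj.
rewrite /normal_quotient wreath_ker_vorbits //; split.
- exact: wreath_ker_normal.
- exact: wreath_is_Cr.
exact: fst_mod_oriented.
Qed.

(** * The product of two cycles and its group for (c) *)

Definition cyc_rel m : rel 'I_m.+3 := fun a b => (b == a + 1)%R || (a == b + 1)%R.

Lemma cyc_rel_sym m : symmetric (@cyc_rel m).
Proof. by move=> a b; rewrite /cyc_rel orbC. Qed.

Lemma card_cyc_rel m (a : 'I_m.+3) : #|[set b | cyc_rel a b]| = 2.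
Proof.
have <- : #|[set (a + 1)%R; (a - 1)%R]| = 2.
  by rewrite cards2 eq_sym subr_eq eq_sym addr1_1_neq.
by apply: eq_card => b; rewrite !inE /cyc_rel [(b == a - 1)%R]eq_sym subr_eq.
Qed.

Section Affine.
Variable m : nat.
Let X := pgraph m (@cyc_rel m).

Definition signed (s : bool) (a : 'I_m.+3) : 'I_m.+3 := (if s then - a else a)%R.

Lemma signedD s : {morph signed s : a b / (a + b)%R}.
Proof. by case: s => // a b; rewrite /signed opprD. Qed.

Lemma signedK s : involutive (signed s).
Proof. by case: s => // a; rewrite /signed opprK. Qed.

Definition affine (p : bool * ('I_m.+3 * 'I_m.+3)) (x : X) : X :=
  (x.1 + p.2.1, signed p.1 x.2 + p.2.2)%R.

Lemma affine_inj p : injective (affine p).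
Proof.
move=> [i a] [j b] /eqP; rewrite xpair_eqE /= => /andP[/eqP/addIr-> /eqP/addIr].
by move/(can_inj (signedK _))->.
Qed.

(** This is the whole direct product of Z_r, translating the first coordinate, with the dihedral
    group of maps a -> t + a and a -> t - a on the second. *)
Definition dihedral_set : {set {perm X}} := [set perm (@affine_inj p) | p : _].

Lemma dihedralP (g : {perm X}) :
  reflect (exists p, forall x, g x = affine p x) (g \in dihedral_set).
Proof.
apply: (iffP imsetP) => [[p _ ->]|[p gp]]; exists p => //.
  by move=> x; rewrite permE.
by apply/permP=> x; rewrite permE gp.
Qed.

Fact dihedral_group_set : group_set dihedral_set.
Proof.
apply/group_setP; split.
  by apply/dihedralP; exists (false, (0, 0))%R => -[i a]; rewrite perm1 /affine /= !addr0.
move=> g h /dihedralP[p gp] /dihedralP[q hq]; apply/dihedralP.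
(* The translation part of the first map passes through the sign of the second. *)
exists (p.1 (+) q.1, (p.2.1 + q.2.1, signed q.1 p.2.2 + q.2.2))%R => x.
rewrite permM gp hq /affine /= signedD !addrA; congr (_, _ + _ + _)%R.
by case: (p.1); case: (q.1); rewrite /signed /= ?opprK.
Qed.
Definition dihedral := Group dihedral_group_set.

Lemma affine_dihedral p : perm (@affine_inj p) \in dihedral.
Proof. by apply/dihedralP; exists p => x; rewrite permE. Qed.

(** A translation preserves both disjuncts of [cyc_rel], and a sign change exchanges them. *)
Lemma cyc_rel_signed s t a b : cyc_rel (signed s a + t)%R (signed s b + t)%R = cyc_rel a b.
Proof.
rewrite /cyc_rel ![(signed s _ + t + 1)%R]addrAC !(inj_eq (addIr _)).
case: s => //=; have E (c d : 'I_m.+3) : (- c == - d + 1)%R = (d == c + 1)%R.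
  by rewrite -subr_eq0 -[RHS]subr_eq0; congr (_ == _); ring.
by rewrite !E orbC.
Qed.

Lemma dihedral_parc (g : {perm X}) x y :
  g \in dihedral -> parc (@cyc_rel m) x y -> parc (@cyc_rel m) (g x) (g y).
Proof.
case/dihedralP=> p gp; rewrite /parc !gp /affine /= cyc_rel_signed => /andP[/eqP-> ->].
by rewrite addrAC eqxx.
Qed.

Lemma dihedral_arc_trans x y x' y' :
    parc (@cyc_rel m) x y -> parc (@cyc_rel m) x' y' ->
  exists2 g : {perm X}, g \in dihedral & g x = x' /\ g y = y'.
Proof.
case: x y x' y' => [i a] [j b] [i' a'] [j' b'].
rewrite /parc /= => /andP[/eqP-> ab] /andP[/eqP-> ab'].
(* A reflection is used exactly when one of the two arcs raises the second coordinate by 1 and the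
   other does not. *)
pose s := (b == a + 1)%R != (b' == a' + 1)%R.
exists (perm (@affine_inj (s, (i' - i, a' - signed s a)%R))); first exact: affine_dihedral.
rewrite !permE /affine /=; split; congr (_, _).
- by rewrite addrC subrK.
- by rewrite addrC subrK.
- by rewrite addrC addrA subrK.
move: ab ab'; rewrite /s /cyc_rel.
have [->|_] := eqVneq b (a + 1)%R; have [->|_] := eqVneq b' (a' + 1)%R => /= ab ab'.
- by ring.
- by move/eqP: ab' => ->; ring.
- by move/eqP: ab => ->; ring.
by move/eqP: ab' ab => -> /eqP->; ring.
Qed.
Lemma dihedral_shift (g : {perm X}) :
  g \in dihedral -> exists c, forall x, ((g x).1 = x.1 + c)%R.
Proof. by case/dihedralP=> p gp; exists p.2.1 => x; rewrite gp. Qed.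

Section Odd.
Hypothesis odd_m : odd m.+3.

(* Moving u times along (1, 1) and v times along (1, -1), with u + v = c and
   u - v = t, is possible because 2 is invertible. *)
Lemma dihedral_connected : gconnected X.
Proof.
(* The residue of (r + 1) / 2, an inverse of 2 because r is odd. *)
pose h : 'I_m.+3 := (m.+4./2)%:R%R.
have h2 : (h + h = 1)%R.
  rewrite /h -natrD addnn even_halfK; last by rewrite oddS odd_m.
  by rewrite -[m.+4]addn1 natrD (pchar_Zp _ : m.+3%:R = 0)%R ?add0r.
have diag n x : connect (@adj X) x (x.1 + n%:R, x.2 + n%:R)%R.
  elim: n => [|n IHn]; first by rewrite !addr0; case: x.
  apply: connect_trans IHn (connect1 _).
  by rewrite /= /padj /parc /cyc_rel /= !mulrSr !addrA !eqxx.
have antidiag n x : connect (@adj X) x (x.1 + n%:R, x.2 - n%:R)%R.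
  elim: n => [|n IHn]; first by rewrite subr0 addr0; case: x.
  apply: connect_trans IHn (connect1 _).
  by rewrite /= /padj /parc /cyc_rel /= !mulrSr !opprD !addrA !subrK !eqxx orbT.
move=> x y; pose c := (y.1 - x.1)%R; pose t := (y.2 - x.2)%R.
apply: connect_trans (diag (c * h + t * h)%R x) _.
have := antidiag (c * h - t * h)%R (x.1 + (c * h + t * h), x.2 + (c * h + t * h))%R.
rewrite !natr_Zp /=.
have -> : (x.1 + (c * h + t * h) + (c * h - t * h) = x.1 + c * (h + h))%R by ring.
have -> : (x.2 + (c * h + t * h) - (c * h - t * h) = x.2 + t * (h + h))%R by ring.
by rewrite h2 !mulr1 /c /t [(x.1 + _)%R]addrC [(x.2 + _)%R]addrC !subrK; case: (y).
Qed.

Lemma OG4_dihedral : OG4 dihedral (parcs m (@cyc_rel m)).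
Proof.
apply: OG4_pgraph => //.
- exact: cyc_rel_sym.
- exact: card_cyc_rel.
- exact: dihedral_parc.
- exact: dihedral_arc_trans.
- exact: (ord0, ord0).
exact: dihedral_connected.
Qed.
End Odd.

(** * Unoriented quotients by the second coordinate *)

Section SndQuotient.
Variable d : nat.
Hypothesis dvd_d : d.+1 %| m.+3.

Definition snd_mod (x : X) : 'I_d.+1 := redn d x.2.

Lemma snd_mod_adj (x y : X) :
  adj x y -> snd_mod y = ordS (snd_mod x) \/ snd_mod x = ordS (snd_mod y).
Proof.
by rewrite /snd_mod => /orP[] /andP[_ /orP[]/eqP->]; rewrite redn1 //; tauto.
Qed.

Lemma snd_mod_onto i : exists x y : X,
  [/\ snd_mod x = i, snd_mod y = ordS i & adj x y].
Proof.
have [j ji] := redn_onto dvd_d i; pose x : X := (0%R, j).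
exists x, (x.1 + 1, x.2 + 1)%R; rewrite /snd_mod redn1 //= ji; split=> //.
by rewrite /padj /parc /cyc_rel !eqxx.
Qed.

(** The bound on [d] makes the residues 0 and [ordS 0] distinct, so that their classes are adjacent;
    edges then run between them in both directions. *)
Lemma snd_mod_not_oriented :
  1 < d.+1 -> ~ oriented (fibres snd_mod) (parcs m (@cyc_rel m)).
Proof.
move=> d_gt1 orient; have [x [y [x0 y1 xy]]] := snd_mod_onto 0%R.
pose P i : quot_graph (fibres snd_mod) := exist _ (fibre snd_mod i) (fibre_in snd_mod_onto i).
have PQ : adj (P 0%R) (P (ordS 0%R)).
  apply/andP; split.
    apply: contraTneq d_gt1 => /(congr1 val)/setP/(_ x) /=; rewrite !inE x0 eqxx => /esym/eqP.
    by move/(congr1 val); rewrite /=; case: (d).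
  by apply/exists_inP; exists x; rewrite ?inE ?x0 //; apply/exists_inP; exists y; rewrite ?inE ?y1.
pose z : 'I_m.+3 := 0%R.
(* Membership in a class ignores the first coordinate, so exchanging [x.2] and [y.2] yields an arc
   between the same two classes in the opposite direction. *)
have arc_out : parc (@cyc_rel m) (z, x.2) (z + 1, y.2)%R.
  rewrite /parc; apply/andP; split; first exact: eqxx.
  by case/orP: xy => /andP[_] //; rewrite cyc_rel_sym.
have arc_in : parc (@cyc_rel m) (z, y.2) (z + 1, x.2)%R.
  rewrite /parc; apply/andP; split; first exact: eqxx.
  by rewrite cyc_rel_sym; case/andP: arc_out.
have fx i : (i, x.2) \in fibre snd_mod 0%R by rewrite inE -[_ (i, _)]/(snd_mod x) x0.
have fy i : (i, y.2) \in fibre snd_mod (ordS 0%R) by rewrite inE -[_ (i, _)]/(snd_mod y) y1.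
have adj_out : padj (@cyc_rel m) (z, x.2) (z + 1, y.2)%R by rewrite /padj arc_out.
have adj_in : padj (@cyc_rel m) (z + 1, x.2)%R (z, y.2) by rewrite /padj arc_in orbT.
case: (orient _ _ PQ) => o; [case/negP: (parc_asym arc_in) | case/negP: (parc_asym arc_out)].
  by have := o _ _ (fx _) (fy _) adj_in; rewrite inE.
by have := o _ _ (fx _) (fy _) adj_out; rewrite inE.
Qed.

Lemma snd_mod_ker_normal : fibre_ker snd_mod dihedral <| dihedral.
Proof.
apply: fibre_ker_normal => g x y /dihedralP[p gp] xy.
rewrite /snd_mod !gp /affine /= !rednD //; congr (_ + _)%R.
by case: (p.1); rewrite /= ?rednN //; congr (- _)%R.
Qed.

(** An arbitrary element carrying [x] to [y] might reflect the second coordinate and permute the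
    classes, so a pure translation is chosen. *)
Lemma snd_mod_vorbits : vorbits (fibre_ker snd_mod dihedral) = fibres snd_mod.
Proof.
apply: vorbits_fibre_ker => x y xy.
exists (perm (@affine_inj (false, (y.1 - x.1, y.2 - x.2)%R))).
  apply/fibre_kerP; split=> [|z]; first exact: affine_dihedral.
  have {}xy : redn d x.2 = redn d y.2 by [].
  by rewrite permE /snd_mod /= !rednD // rednN // xy subrr addr0.
by rewrite permE /affine /= [(x.1 + _)%R]addrC [(x.2 + _)%R]addrC !subrK; case: (y).
Qed.
End SndQuotient.
End Affine.

(** Both families use the same prime lengths, since coprimality is required only within each
    family. *)
Lemma exists_oriented_and_unoriented n : 0 < n ->
  exists (X : sgraph) (G : {group {perm X}}) (D : {set X * X}),
    OG4 G D /\
    exists (N M : 'I_n -> {group {perm X}}) (r s : 'I_n -> nat),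
      [/\ [/\ injective (fun i => vorbits (N i)),
              injective (fun i => vorbits (M i))
            & forall i j, vorbits (N i) <> vorbits (M j)],
          (forall i, [/\ N i <| G, is_Cr (normal_quotient (N i)) (r i)
                       & oriented (vorbits (N i)) D]),
          (forall i, [/\ M i <| G, is_Cr (normal_quotient (M i)) (s i)
                       & ~ oriented (vorbits (M i)) D])
        & forall i j, i != j ->
            gcdn (r i) (r j) = 1%N /\ gcdn (s i) (s j) = 1%N].
Proof.
case/coprime_moduli=> m [d [odd_m d_inj dvd_d d_coprime]].
pose X := pgraph m (@cyc_rel m); pose D := parcs m (@cyc_rel m).
have dvd i : (d i).+1 %| m.+3 by have [] := dvd_d i.
have gt2 i : 2 < (d i).+1 by have [] := dvd_d i.
pose N i := fibre_ker (@fst_mod m _ (@cyc_rel m) (d i)) (dihedral m).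
pose M i := fibre_ker (@snd_mod m (d i)) (dihedral m).
have vN i : vorbits (N i) = fibres (@fst_mod m _ (@cyc_rel m) (d i)).
  apply: fst_mod_vorbits => //; first exact: card_cyc_rel.
    exact: dihedral_arc_trans.
  exact: dihedral_shift.
have vM i : vorbits (M i) = fibres (@snd_mod m (d i)) by apply: snd_mod_vorbits.
have adjN i := @fst_mod_adj m _ (@cyc_rel m) _ (dvd i).
have ontoN i := @fst_mod_onto m _ (@cyc_rel m) (@card_cyc_rel m) _ (dvd i) (ord0, ord0).
have adjM i := @snd_mod_adj m _ (dvd i).
have ontoM i := @snd_mod_onto m _ (dvd i).
have orientN i : oriented (vorbits (N i)) D by rewrite vN; apply: fst_mod_oriented.
have orientM i : ~ oriented (vorbits (M i)) D.
  by rewrite vM; apply: snd_mod_not_oriented; rewrite // ltnW.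
exists X, (dihedral m), D; split; first exact: OG4_dihedral.
exists N, M, (fun i => (d i).+1), (fun i => (d i).+1); split.
(* Within a family the quotients differ in their numbers of vertices; across the families one is
   oriented and the other is not. *)
- split=> [i j|i j|i j E]; last by apply: (orientM j); rewrite -E.
    move/(congr1 (fun P => #|quot_graph P|)).
    by rewrite !vN !(card_fibres (@adjN _) (@ontoN _)) => -[/d_inj].
  move/(congr1 (fun P => #|quot_graph P|)).
  by rewrite !vM !(card_fibres (@adjM _) (@ontoM _)) => -[/d_inj].
- move=> i; split=> //; first by apply: fst_mod_ker_normal => //; apply: dihedral_shift.
  by rewrite /normal_quotient vN; exact: (is_Cr_fibres (@adjN i) (@ontoN i)).
- move=> i; split=> //; first exact: snd_mod_ker_normal.
  by rewrite /normal_quotient vM; exact: (is_Cr_fibres (@adjM i) (@ontoM i)).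
by move=> i j /d_coprime/eqP.
Qed.

Theorem theorem1 (n : nat) (n_gt0 : 0 < n) :
  [/\
  (* (a) *)
  exists (X : sgraph) (G : {group {perm X}}) (D : {set X * X}),
    [/\ OG4 G D, basic G,
        #|nontriv_intrans_quotients G| = n,
        (forall P Q, P \in nontriv_intrans_quotients G ->
           Q \in nontriv_intrans_quotients G -> P <> Q ->
           ~ giso (quot_graph P) (quot_graph Q))
      & forall P, P \in nontriv_intrans_quotients G ->
           is_cycle (quot_graph P) /\ oriented P D],
  (* (b) *)
  exists (X : sgraph) (G : {group {perm X}}) (D : {set X * X}),
    [/\ OG4 G D, basic G
      & exists (N : 'I_n -> {group {perm X}}) (r : 'I_n -> nat),
        [/\ injective (fun i => vorbits (N i)),
            (forall i, [/\ N i <| G, is_Cr (normal_quotient (N i)) (r i)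
                         & oriented (vorbits (N i)) D])
          & forall i j, i != j -> coprime (r i) (r j)]]
  & (* (c) *)
  exists (X : sgraph) (G : {group {perm X}}) (D : {set X * X}),
    OG4 G D /\
    exists (N M : 'I_n -> {group {perm X}}) (r s : 'I_n -> nat),
      [/\ [/\ injective (fun i => vorbits (N i)),
              injective (fun i => vorbits (M i))
            & forall i j, vorbits (N i) <> vorbits (M j)],
          (forall i, [/\ N i <| G, is_Cr (normal_quotient (N i)) (r i)
                       & oriented (vorbits (N i)) D]),
          (forall i, [/\ M i <| G, is_Cr (normal_quotient (M i)) (s i)
                       & ~ oriented (vorbits (M i)) D])
        & forall i j, i != j ->
            gcdn (r i) (r j) = 1%N /\ gcdn (s i) (s j) = 1%N]].
Proof.
by split; [apply: exists_basic_n_oriented | apply: exists_basic_coprime_oriented | apply: exists_oriented_and_unoriented].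
Qed.
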